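(* Let $L,T,K>0$, $1<\beta\le 2$, let $M\ge 2$, $N\ge1$, $J\ge1$ be integers, and let $h=L/M$, $\tau=T/N$, $x_i=ih$, $t_n=n\tau$, $t_{n-1+\sigma}=(n-1+\sigma)\tau$, where $\sigma\in[\frac12,1]$, the coefficients $\hat c_k^{(n)}$ and $g_k^{(\beta)}$ are as defined in the context. Given functions $f$ and $\phi$, put $f_i^{n-1+\sigma}=f(x_i,t_{n-1+\sigma})$. Then the difference scheme $$\sum_{k=0}^{n-1}\hat c_k^{(n)}\left(u_i^{n-k}-u_i^{n-k-1}\right)=-Kh^{-\beta}\sum_{k=i-M}^{i}g_k^{(\beta)}\left[\sigma u_{i-k}^n+(1-\sigma)u_{i-k}^{n-1}\right]+f_i^{n-1+\sigma},\quad 1\le i\le M-1,\ 1\le n\le N,$$ $$u_0^n=0,\quad u_M^n=0,\quad 0\le n\le N,\qquad u_i^0=\phi(x_i),\quad 1\le i\le M-1,$$ is uniquely solvable, i.e. there is exactly one family $\{u_i^n : 0\le i\le M,\ 0\le n\le N\}$ of real numbers satisfying it.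
   Context: Weight function: $\omega:[0,1]\to\mathbb{R}$ satisfies $\omega(\alpha)\ge 0$ and $\omega(\alpha)\ne0$ for $\alpha\in[0,1]$, and $0<\int_0^1\omega(\alpha)\,d\alpha<\infty$. Set $m=2J$, $\Delta\alpha=\frac1{2J}$, $\alpha_r=r\Delta\alpha$ for $0\le r\le m$, $d_0=d_m=\frac12$, $d_r=1$ for $1\le r\le m-1$, and $\lambda_r=d_r\omega(\alpha_r)\Delta\alpha>0$. $\sigma$ is the unique positive root (it lies in $[\frac12,1]$) of $$F(\sigma)=\sum_{r=0}^{m}\frac{\lambda_r}{\Gamma(3-\alpha_r)}\sigma^{1-\alpha_r}\left[\sigma-\left(1-\frac{\alpha_r}{2}\right)\right]\tau^{2-\alpha_r}=0 .$$ For $\alpha\in[0,1]$ let $a_0^{(\alpha)}=\sigma^{1-\alpha}$ and, for $l\ge1$, $a_l^{(\alpha)}=(l+\sigma)^{1-\alpha}-(l-1+\sigma)^{1-\alpha}$ and $$b_l^{(\alpha)}=\frac{1}{2-\alpha}\left[(l+\sigma)^{2-\alpha}-(l-1+\sigma)^{2-\alpha}\right]-\frac12\left[(l+\sigma)^{1-\alpha}+(l-1+\sigma)^{1-\alpha}\right].$$ Let $c_0^{(1,\alpha)}=a_0^{(\alpha)}$, and for $n\ge2$: $c_0^{(n,\alpha)}=a_0^{(\alpha)}+b_1^{(\alpha)}$; $c_k^{(n,\alpha)}=a_k^{(\alpha)}+b_{k+1}^{(\alpha)}-b_k^{(\alpha)}$ for $1\le k\le n-2$; $c_{n-1}^{(n,\alpha)}=a_{n-1}^{(\alpha)}-b_{n-1}^{(\alpha)}$.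 Define $$\hat c_k^{(n)}=\sum_{r=0}^{m}\lambda_r\frac{\tau^{-\alpha_r}}{\Gamma(2-\alpha_r)}c_k^{(n,\alpha_r)},\quad 0\le k\le n-1 .$$ For $k\in\mathbb{Z}$, $g_k^{(\beta)}=\dfrac{(-1)^k\Gamma(\beta+1)}{\Gamma(\beta/2-k+1)\Gamma(\beta/2+k+1)}$, with the convention $1/\Gamma(z)=0$ at the poles of $\Gamma$. *)

(* Defs.v *)
From HB Require Import structures.
From mathcomp Require Import all_boot all_order all_algebra.
From mathcomp Require Import all_classical all_reals all_analysis.

Set Implicit Arguments.
Unset Strict Implicit.
Unset Printing Implicit Defensive.

Import Order.TTheory GRing.Theory Num.Theory.
Import numFieldNormedType.Exports.

Local Open Scope classical_set_scope.
Local Open Scope ring_scope.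

Section Gamma.
Variable R : realType.

Definition gamma_integral (x : R) : R :=
  \int[lebesgue_measure]_(t in `]0, +oo[) (t `^ (x - 1) * expR (- t)).

(* Euler's integral for 0 < x, continued to the other reals by
   Gamma x = Gamma (x + n) / (x (x + 1) ... (x + n - 1)), where
   n = Num.truncn (1 - x) is the least natural number with 0 < x + n.
   At a pole x = 0, -1, -2, ... one factor of the product is 0, so that
   Gamma x = 0 and (Gamma x)^-1 = 0: in denominators this realizes the
   convention 1 / Gamma x = 0. *)
Definition Gamma (x : R) : R :=
  let n := Num.truncn (1 - x) in
  gamma_integral (x + n%:R) / \prod_(0 <= j < n) (x + j%:R).

End Gamma.

Section Coefficients.
Variable R : realType.

Definition dalpha (J : nat) : R := (J.*2)%:R^-1.

Definition alpha (J r : nat) : R := r%:R * dalpha J.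

Definition dweight (J r : nat) : R :=
  if (r == 0)%N || (r == J.*2)%N then 2^-1 else 1.

Definition lambda (omega : R -> R) (J r : nat) : R :=
  dweight J r * omega (alpha J r) * dalpha J.

Definition Fsigma (omega : R -> R) (J : nat) (tau s : R) : R :=
  \sum_(0 <= r < J.*2.+1)
    lambda omega J r / Gamma (3 - alpha J r) * s `^ (1 - alpha J r)
      * (s - (1 - alpha J r / 2)) * tau `^ (2 - alpha J r).

Definition acoef (sigma : R) (l : nat) (a : R) : R :=
  if l is l'.+1 then
    (l%:R + sigma) `^ (1 - a) - (l'%:R + sigma) `^ (1 - a)
  else sigma `^ (1 - a).

(* used for 1 <= l only *)
Definition bcoef (sigma : R) (l : nat) (a : R) : R :=
  (2 - a)^-1 * ((l%:R + sigma) `^ (2 - a) - (l%:R - 1 + sigma) `^ (2 - a))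
  - 2^-1 * ((l%:R + sigma) `^ (1 - a) + (l%:R - 1 + sigma) `^ (1 - a)).

(* used for 1 <= n and k <= n - 1 only; the last case is k = n - 1 *)
Definition ccoef (sigma : R) (n k : nat) (a : R) : R :=
  if n == 1%N then acoef sigma 0 a
  else if k == 0%N then acoef sigma 0 a + bcoef sigma 1 a
  else if (k <= n - 2)%N then
    acoef sigma k a + bcoef sigma k.+1 a - bcoef sigma k a
  else acoef sigma k a - bcoef sigma k a.

Definition chat (omega : R -> R) (J : nat) (tau sigma : R) (n k : nat) : R :=
  \sum_(0 <= r < J.*2.+1)
    lambda omega J r * (tau `^ (- alpha J r) / Gamma (2 - alpha J r))
      * ccoef sigma n k (alpha J r).

Definition gcoef (beta : R) (k : int) : R :=
  (-1) ^ k * Gamma (beta + 1)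
    / (Gamma (beta / 2 - k%:~R + 1) * Gamma (beta / 2 + k%:~R + 1)).

(* The space sum over k = i - M, ..., i is written with the index
   j = i - k = 0, ..., M. *)
Definition difference_scheme (omega : R -> R) (J M N : nat)
    (L T K beta sigma : R) (f : R -> R -> R) (phi : R -> R)
    (u : nat -> nat -> R) : Prop :=
  let h := L / M%:R in
  let tau := T / N%:R in
  [/\ forall i n, (1 <= i <= M - 1)%N -> (1 <= n <= N)%N ->
        \sum_(0 <= k < n)
          chat omega J tau sigma n k * (u i (n - k)%N - u i (n - k - 1)%N)
        = - K * h `^ (- beta)
            * (\sum_(0 <= j < M.+1) gcoef beta (i%:Z - j%:Z)
                * (sigma * u j n + (1 - sigma) * u j (n - 1)%N))
          + f (i%:R * h) ((n%:R - 1 + sigma) * tau),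
      forall n, (n <= N)%N -> u 0%N n = 0 /\ u M n = 0
    & forall i, (1 <= i <= M - 1)%N -> u i 0%N = phi (i%:R * h)].

End Coefficients.

(* Main.v *)
Require Import Defs.
From HB Require Import structures.
From mathcomp Require Import all_boot all_order all_algebra.
From mathcomp Require Import all_classical all_reals all_analysis.
From mathcomp Require Import measurable_realfun ring lra zify.
Import Order.TTheory GRing.Theory Num.Theory.
Import numFieldNormedType.Exports.

(** At level n the scheme is a linear system for the vector of the u_i^n.  Put
    kappa = K h^-beta.  Collecting the unknowns on the left, the interior row i is
      c_0 u_i^n + kappa sigma \sum_j g_(i-j) u_j^n = known,
    where c_0 is the leading temporal coefficient, and the two boundary rows
    say u_0^n = u_M^n = 0.  The system is kept at full size M + 1, with
    identity rows for the boundary.  Its matrix is strictly diagonally dominant,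
    hence invertible, so that the levels are computed one after the other and in
    only one way ([exists_unique_implicit_steps]).

    Dominance rests on two facts.

    First, c_0 > 0 ([chat0_gt0]).  Every term of the sum over r is nonnegative,
    and the one with alpha_r = 1 is positive because Gamma 1 = 1.  For one
    exponent a and n >= 2, (2 - a) (a_0 + b_1) is a combination of the powers
    s^(1 - a) <= (1 + s)^(1 - a) that is visibly positive ([ccoef0_gt0]).

    Second, the off-diagonal |g_(i-j)| in a row add up to at most g_0
    ([sum_offdiag_gcoef]).  The functional equation of Gamma gives
      g_(k+1) (k + 1 + beta/2) = g_k (k - beta/2).
    As beta <= 2, it makes all g_k with k >= 1 nonpositive, and it telescopes to
      beta \sum_(1 <= k <= n) (- g_k) = (beta/2) g_0 + g_n (n - beta/2),
    where the last term is nonpositive.  Hence each side of the diagonal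
    contributes at most g_0 / 2.

    The functional equation itself is integration by parts in Euler's integral
    ([gamma_integralD1]), carried out on compact intervals that exhaust
    ]0, +oo[ because the integrand may be singular at 0. *)

Local Open Scope classical_set_scope.
Local Open Scope ring_scope.

(** * The functional equation of the Gamma function *)

(** The exponential series dominates any power: b^x <= b^m and
    b^(m+1) / (m+1)! <= e^b leave the bound (m+1)! / b. *)
Lemma cvgn_powR_expRN {R : realType} (x : R) :
  (fun n => n.+1%:R `^ x * expR (- n.+1%:R) : R) @ \oo --> (0 : R).
Proof.
pose m := (Num.truncn x).+1.
have mf0 : 0 < (m.+1`!%:R : R) by rewrite ltr0n fact_gt0.
apply: (@squeeze_cvgr _ _ _ _ (fun=> 0) (fun n => m.+1`!%:R * harmonic n : R)).
- near=> n; rewrite mulr_ge0 ?powR_ge0 ?expR_ge0//= expRN.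
  set b : R := n.+1%:R.
  have b0 : 0 < b by rewrite ltr0n.
  have b1 : 1 <= b by rewrite ler1n.
  have bm : b `^ x <= b ^+ m.
    rewrite -(powR_mulrn _ (ltW b0)); apply: (ler_powR b1).
    exact/ltW/truncnS_gt.
  have eb : b ^+ m.+1 / m.+1`!%:R <= expR b.
    by apply: le_trans (expR_ge1Dxn m (ltW b0)); rewrite lerDr.
  rewrite ler_pdivrMr ?expR_gt0//; apply: le_trans bm _.
  have -> : b ^+ m = m.+1`!%:R * b^-1 * (b ^+ m.+1 / m.+1`!%:R).
    by rewrite exprS -!mulrA mulKf ?gt_eqF// [RHS]mulrC divfK ?gt_eqF.
  by rewrite ler_pM2l// mulr_gt0// invr_gt0.
- exact: cvg_cst.
- rewrite -[X in _ --> X](mulr0 (m.+1`!%:R)).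
  by apply: cvgM; [exact: cvg_cst|exact: cvg_harmonic].
Unshelve. all: by end_near. Qed.

Lemma cvgn_invS_powR_expRN {R : realType} (x : R) : 0 < x ->
  (fun n => n.+1%:R^-1 `^ x * expR (- n.+1%:R^-1) : R) @ \oo --> (0 : R).
Proof.
move=> x0; apply: (@squeeze_cvgr _ _ _ _ (fun=> 0) (fun n => harmonic n `^ x : R)).
- near=> n; rewrite mulr_ge0 ?powR_ge0 ?expR_ge0//=.
  by rewrite ler_piMr ?powR_ge0// expR_le1 oppr_le0 invr_ge0.
- exact: cvg_cst.
- apply: (cvg_at_rightP (fun a : R => a `^ x) 0 0).1 => //.
  exact: powR_cvg0.
  by split; [move=> n; exact: harmonic_gt0 | exact: cvg_harmonic].
Unshelve. all: by end_near. Qed.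

Lemma is_derive_expRN {R : realType} (t : R) :
  is_derive t 1 (fun t : R => expR (- t)) (- expR (- t)).
Proof.
have := @is_derive1_comp R expR -%R t (expR (- t)) (-1) (is_derive_expR _) _.
by rewrite mulrN1; apply.
Qed.

Lemma derivable_cc_LRcontinuous {R : realType} (f : R -> R) (a b : R) :
  a < b -> {in `[a, b], forall t, derivable f t 1} ->
  derivable_oo_LRcontinuous f a b.
Proof.
move=> ab df; have cf t : t \in `[a, b] -> f x @[x --> t] --> f t.
  by move=> /df dft; apply: differentiable_continuous; exact/derivable1_diffP.
split.
- by move=> t tab; apply: df; exact: subset_itv_oo_cc tab.
- by apply: cvg_at_right_filter; apply: cf; rewrite in_itv/= lexx ltW.
- by apply: cvg_at_left_filter; apply: cf; rewrite in_itv/= lexx ltW.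
Qed.

Lemma integral_powR_expR_by_parts {R : realType} (x a b : R) : 0 < a < b ->
  (\int[lebesgue_measure]_(t in `[a, b]) (x * (t `^ (x - 1) * expR (- t)))%:E =
   (b `^ x * expR (- b) - a `^ x * expR (- a))%:E +
   \int[lebesgue_measure]_(t in `[a, b]) (t `^ x * expR (- t))%:E)%E.
Proof.
move=> /andP[a0 ab].
have itv_gt0 t : t \in `[a, b] -> 0 < t.
  by rewrite in_itv/= => /andP[+ _]; exact: lt_le_trans.
have dpow y t : t \in `[a, b] -> is_derive t 1 (@powR R ^~ y) (y * t `^ (y - 1)).
  by move=> /itv_gt0 t0; exact: is_derive1_powR.
have dexp t : t \in `[a, b] ->
    is_derive t 1 (fun t : R => expR (- t)) (- expR (- t)).
  by move=> _; exact: is_derive_expRN.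
have cpow y : {within `[a, b], continuous (fun t : R => y * t `^ (y - 1))}.
  apply: derivable_within_continuous => t tab.
  apply: derivableM; first exact: derivable_cst.
  by have /@ex_derive := dpow (y - 1) t tab.
have cexp : {within `[a, b], continuous (fun t : R => - expR (- t))}.
  apply: derivable_within_continuous => t tab.
  apply: derivableN.
  by have /@ex_derive := dexp t tab.
transitivity (\int[lebesgue_measure]_(t in `[a, b])
    (expR (- t) * (x * t `^ (x - 1)))%:E)%E.
  by apply: eq_integral => t _; rewrite mulrA mulrC.
rewrite (@integration_by_parts R (fun t => expR (- t)) (@powR R ^~ x) _ _ a b ab
  cexp _ _ (cpow x)).
- congr (_ + _)%E; first by rewrite ![expR _ * _]mulrC.
  rewrite -[RHS]oppeK; congr (- _)%E.
  rewrite -integral_ge0N; last first.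
    by move=> t _; rewrite lee_fin mulr_ge0 ?powR_ge0 ?expR_ge0.
  by apply: eq_integral => t _; rewrite mulNr EFinN mulrC.
- apply: derivable_cc_LRcontinuous => // t /dexp[].
- move=> t /subset_itv_oo_cc/dexp[_]; by rewrite derive1E.
- by apply: derivable_cc_LRcontinuous => // t /(dpow x)[].
- move=> t /subset_itv_oo_cc/(dpow x)[_]; by rewrite derive1E.
Qed.

Lemma measurable_gamma_integrand {R : realType} (y : R) (D : set R) :
  measurable_fun D (fun t : R => t `^ y * expR (- t)).
Proof.
apply: measurable_funM; first exact: (measurable_funTS (@measurable_powR R y)).
apply: (measurableT_comp (@measurable_expR R)).
exact: oppr_measurable.
Qed.

(** Monotone convergence: any integral over ]0, +oo[ below can be computed on
    compact intervals, where the integrand is smooth even if it blows up at 0.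
    The right end n + 2 keeps the interval nondegenerate for n = 0. *)
Lemma cvg_compact_exhaustion_gamma {R : realType} (y : R) :
  (\int[lebesgue_measure]_(t in `[n.+1%:R^-1%R, n.+2%:R%R]) (t `^ y * expR (- t))%:E)%E
    @[n --> \oo] -->
  (\int[lebesgue_measure]_(t in `]0%R, +oo[) (t `^ y * expR (- t))%:E)%E.
Proof.
have -> : [set` `]0, +oo[] = \bigcup_n [set` `[n.+1%:R^-1, n.+2%:R]] :> set R.
  apply/seteqP; split => t /=.
    rewrite in_itv/= andbT => t0.
    pose n := maxn (Num.truncn t^-1) (Num.truncn t).
    exists n => //=; rewrite in_itv/=; apply/andP; split.
      rewrite invf_ple ?posrE ?ltr0n//; apply: le_trans (ltW (truncnS_gt _)) _.
      by rewrite ler_nat ltnS leq_maxl.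
    apply: le_trans (ltW (truncnS_gt _)) _.
    by rewrite ler_nat ltnS leqW// leq_maxr.
  move=> [n _] /=; rewrite !in_itv/= andbT => /andP[+ _].
  by apply: lt_le_trans; rewrite invr_gt0 ltr0n.
pose F n : set (measurableTypeR R) := [set` `[n.+1%:R^-1, n.+2%:R]].
have := @ge0_nondecreasing_set_cvg_integral _ _ _ F
  (fun t => (t `^ y * expR (- t))%:E) lebesgue_measure.
apply.
- move=> m n mn; apply/subsetPset => t; rewrite /F/= !in_itv/= => /andP[mt tm].
  apply/andP; split.
    by apply: le_trans mt; rewrite lef_pV2 ?posrE ?ltr0n// ler_nat ltnS.
  by apply: le_trans tm _; rewrite ler_nat !ltnS.
- by move=> n; exact: measurable_itv.
- by move=> n; apply/measurable_EFinP; exact: measurable_gamma_integrand.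
- by move=> n t _; rewrite lee_fin mulr_ge0 ?powR_ge0 ?expR_ge0.
Qed.

(** Both sides are limits of integrals over compact intervals, where they differ
    by the boundary term of the integration by parts, which tends to 0.  The
    comparison takes place in the extended reals, so that no convergence of
    Euler's integral has to be known beforehand. *)
Lemma gamma_integralD1 {R : realType} (x : R) : 0 < x ->
  gamma_integral (x + 1) = x * gamma_integral x.
Proof.
move=> x0; rewrite /gamma_integral addrK /Rintegral.
set I := integral _ _ _; set I' := integral _ _ _.
suff -> : I = (x%:E * I')%E.
  have : (0 <= I')%E.
    by apply: integral_ge0 => t _; rewrite lee_fin mulr_ge0 ?powR_ge0 ?expR_ge0.
  (* an infinite integral counts as 0 in R, and x * +oo = +oo *)
  case: I' => [r _|_|//]; first by rewrite -EFinM.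
  by rewrite gt0_muley ?lte_fin//= mulr0.
apply: (cvg_unique (@ereal_hausdorff R) (@cvg_compact_exhaustion_gamma R x)).
pose bnd n : R := n.+2%:R `^ x * expR (- n.+2%:R) -
                  n.+1%:R^-1 `^ x * expR (- n.+1%:R^-1).
have bnd0 : (- bnd n)%:E @[n --> \oo] --> 0%E.
  apply: cvg_EFin; first exact: nearW.
  rewrite -oppr0; apply: cvgN; rewrite -[0]subr0; apply: cvgB.
    by have := cvgn_powR_expRN x; rewrite -cvg_shiftS.
  exact: cvgn_invS_powR_expRN.
rewrite /= -[X in _ --> X]add0e.
have xI' : (x%:E * (\int[lebesgue_measure]_(t in `[n.+1%:R^-1%R, n.+2%:R%R])
    (t `^ (x - 1) * expR (- t))%:E))%E @[n --> \oo] --> (x%:E * I')%E.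
  by apply: cvgeZl => //; exact: cvg_compact_exhaustion_gamma.
have := cvgeD _ bnd0 xI'; rewrite fin_num_adde_defr// => /(_ _ isT).
apply: cvg_trans; apply: near_eq_cvg; near=> n.
rewrite -ge0_integralZl_EFin ?ltW//; last 2 first.
- by move=> t _; rewrite lee_fin mulr_ge0 ?powR_ge0 ?expR_ge0.
- by apply/measurable_EFinP; exact: measurable_gamma_integrand.
under eq_integral do rewrite -EFinM.
rewrite integral_powR_expR_by_parts; last first.
  rewrite invr_gt0 ltr0n/= (@le_lt_trans _ _ 1) ?ltr1n//.
  by rewrite invf_le1 ?ltr0n// ler1n.
by rewrite addeA -EFinD addNr add0e.
Unshelve. all: by end_near. Qed.

Lemma Gamma_gt0E {R : realType} (x : R) : 0 < x -> Gamma x = gamma_integral x.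
Proof.
move=> x0; rewrite /Gamma.
have -> : Num.truncn (1 - x) = 0%N.
  by apply/eqP; rewrite -leqn0 truncn_le_nat ltrBlDr ltrDl.
by rewrite addr0 big_geq// divr1.
Qed.

Lemma Gamma_ge0 {R : realType} (x : R) : 0 < x -> 0 <= Gamma x.
Proof.
move=> x0; rewrite Gamma_gt0E//; apply: Rintegral_ge0 => t _.
by rewrite mulr_ge0 ?powR_ge0 ?expR_ge0.
Qed.

(** In terms of 1 / Gamma the functional equation holds at every real number: at
    a pole both sides are 0. *)
Lemma invr_GammaD1 {R : realType} (x : R) :
  (Gamma x)^-1 = x * (Gamma (x + 1))^-1.
Proof.
case: (ltP 0 x) => x0.
  rewrite !Gamma_gt0E ?addr_gt0// gamma_integralD1// invfM mulrA.
  by rewrite divff ?gt_eqF// mul1r.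
rewrite /Gamma opprD addrCA [1 - 1]subrr addr0.
have -> : Num.truncn (1 - x) = (Num.truncn (- x)).+1.
  have /andP[nx xn] : (Num.truncn (- x))%:R <= - x < (Num.truncn (- x)).+1%:R.
    by rewrite truncn_itv// oppr_ge0.
  by apply: truncn_def; rewrite -natr1 -[in ltRHS]natr1 ![_%:R + 1]addrC lerD2l ltrD2l nx.
set n := Num.truncn (- x).
rewrite big_nat_recl// addr0 !invfM !invrK -natr1 [n%:R + 1]addrC addrA.
rewrite [RHS]mulrCA; congr (_ * (_ * _)).
by apply: eq_bigr => j _; rewrite -natr1 [j%:R + 1]addrC addrA.
Qed.

Lemma Gamma1 {R : realType} : Gamma 1 = 1 :> R.
Proof.
rewrite Gamma_gt0E// /gamma_integral subrr.
under eq_Rintegral do rewrite powRr0 mul1r.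
have dexp (t : R) : is_derive t 1 (fun t => - expR (- t)) (expR (- t)).
  by rewrite -[X in is_derive _ _ _ X]opprK; apply: is_deriveN; exact: is_derive_expRN.
have cexp : continuous (fun t : R => expR (- t)).
  by move=> t; apply: continuous_comp; [exact: continuousN|exact: continuous_expR].
rewrite /Rintegral integral_itv_obnd_cbnd; last first.
  apply/measurable_EFinP; apply: (measurableT_comp (@measurable_expR R)).
  exact: oppr_measurable.
rewrite (@ge0_continuous_FTC2y _ _ (fun t => - expR (- t)) 0 0).
- by rewrite oppr0 expR0 sub0e /= opprK.
- by move=> t _; exact: expR_ge0.
- exact: continuous_subspaceT.
- by rewrite -oppr0; apply: cvgN; exact: cvgr_expR.
- by move=> t _; case: (dexp t).
- apply: cvg_at_right_filter; by apply: cvgN; exact: cexp.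
- by move=> t _; rewrite derive1E; case: (dexp t).
Qed.

(** * The coefficients of the fractional difference *)

Lemma gcoefN {R : realType} (beta : R) (k : nat) :
  gcoef beta (- k%:Z) = gcoef beta k%:Z.
Proof.
rewrite /gcoef -exprnN invr_sign -exprnP rmorphN/= opprK.
by rewrite [X in _ / X]mulrC.
Qed.

Lemma gcoefE {R : realType} (beta : R) (k : nat) :
  gcoef beta k%:Z = (-1) ^+ k * Gamma (beta + 1)
    / (Gamma (beta / 2 - k%:R + 1) * Gamma (beta / 2 + k%:R + 1)).
Proof. by []. Qed.

(** Passing from k to k + 1 lowers the argument of one Gamma factor by 1 and
    raises that of the other; the sign turns beta/2 - k into k - beta/2. *)
Lemma gcoefS {R : realType} (beta : R) (k : nat) :
  gcoef beta k.+1%:Z * (k.+1%:R + beta / 2) = gcoef beta k%:Z * (k%:R - beta / 2).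
Proof.
rewrite !gcoefE exprS.
have -> : beta / 2 - k.+1%:R + 1 = beta / 2 - k%:R by rewrite -natr1; lra.
have -> : beta / 2 + k.+1%:R + 1 = beta / 2 + k%:R + 1 + 1 by rewrite -natr1; lra.
rewrite !(invfM (Gamma _)).
rewrite (invr_GammaD1 (beta / 2 - k%:R)) (invr_GammaD1 (beta / 2 + k%:R + 1)).
rewrite -natr1; ring.
Qed.

Lemma gcoef0_ge0 {R : realType} (beta : R) : 0 < beta -> 0 <= gcoef beta 0.
Proof.
move=> beta0.
rewrite /gcoef expr0z mul1r subr0 addr0.
by apply: divr_ge0; last apply: mulr_ge0; apply: Gamma_ge0; lra.
Qed.

(** By the recurrence, g_1 has the sign of - g_0, and the factors k - beta/2 with
    k >= 1 that lead from g_1 to the later coefficients are nonnegative. *)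
Lemma gcoef_le0 {R : realType} (beta : R) (k : nat) :
  0 < beta <= 2 -> gcoef beta k.+1%:Z <= 0.
Proof.
move=> /andP[b0 b2]; have pos (l : nat) : 0 < l.+1%:R + beta / 2.
  by have : 0 <= l.+1%:R :> R; [exact: ler0n|lra].
elim: k => [|k IHk].
  rewrite -(pmulr_lle0 _ (pos 0%N)) gcoefS.
  by rewrite sub0r mulrN oppr_le0 mulr_ge0 ?gcoef0_ge0//; lra.
rewrite -(pmulr_lle0 _ (pos k.+1)) gcoefS.
by rewrite mulr_le0_ge0// subr_ge0 (@le_trans _ _ 1) ?ler1n//; lra.
Qed.

(** The full series of the g_k over all integers is 0; its truncation is
    controlled here in closed form, by telescoping the recurrence. *)
Lemma sum_gcoef_le_half {R : realType} (beta : R) (n : nat) : 0 < beta <= 2 ->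
  \sum_(0 <= k < n) - gcoef beta k.+1%:Z <= gcoef beta 0 / 2.
Proof.
move=> /andP[b0 b2].
have half_sumE : beta * (\sum_(0 <= k < n) - gcoef beta k.+1%:Z) =
    beta / 2 * gcoef beta 0 + gcoef beta n%:Z * (n%:R - beta / 2).
  elim: n => [|n IHn]; first by rewrite big_geq// (_ : 0%:Z = 0)//; ring.
  rewrite big_nat_recr//= mulrDr IHn -(gcoefS beta n); by field.
suff : beta * (\sum_(0 <= k < n) - gcoef beta k.+1%:Z) <= beta * (gcoef beta 0 / 2).
  by rewrite ler_pM2l.
rewrite half_sumE.
have : gcoef beta n%:Z * (n%:R - beta / 2) <= 0; last by lra.
case: n {half_sumE} => [|n].
  by rewrite sub0r mulrN oppr_le0 mulr_ge0 ?gcoef0_ge0//; lra.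
rewrite mulr_le0_ge0 ?gcoef_le0 ?b0// subr_ge0 (@le_trans _ _ 1) ?ler1n//; lra.
Qed.

(** Left and right of the diagonal, the row runs through g_1, g_2, ... up to
    symmetry, so that two half sums are added. *)
Lemma sum_offdiag_gcoef {R : realType} (beta : R) (M : nat) (i : 'I_M.+1) :
  0 < beta <= 2 ->
  \sum_(j < M.+1 | j != i) `|gcoef beta (i%:Z - j%:Z)| <= gcoef beta 0.
Proof.
move=> b02; have normg (k : nat) : `|gcoef beta k.+1%:Z| = - gcoef beta k.+1%:Z.
  by rewrite ler0_norm// gcoef_le0.
rewrite -(big_mkord (fun j => j != i :> nat) (fun j => `|gcoef beta (i%:Z - j%:Z)|)).
rewrite (@big_cat_nat _ _ _ i)//= ?(ltnW (ltn_ord i))//.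
rewrite [X in _ + X]big_ltn_cond//= eqxx/=.
have -> : \sum_(0 <= j < i | j != i) `|gcoef beta (i%:Z - j%:Z)| =
    \sum_(0 <= k < i) - gcoef beta k.+1%:Z.
  rewrite big_nat_rev add0n big_nat_cond [RHS]big_nat_cond.
  apply: eq_big => [k|k /andP[/andP[_ ki] _]]; first by lia.
  by rewrite -normg; congr (`|gcoef beta _|); lia.
have -> : \sum_(i.+1 <= j < M.+1 | j != i) `|gcoef beta (i%:Z - j%:Z)| =
    \sum_(0 <= k < M - i) - gcoef beta k.+1%:Z.
  rewrite -[in LHS](add0n i.+1) big_addn subSS big_nat_cond [RHS]big_nat_cond.
  apply: eq_big => [k|k _]; first by lia.
  by rewrite -normg -gcoefN; congr (`|gcoef beta _|); lia.
by rewrite [leRHS]splitr; apply: lerD; exact: sum_gcoef_le_half.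
Qed.

(** * The leading temporal coefficient *)

(** For n = 1 the coefficient is a power of s.  Otherwise it is a_0 + b_1: with
    Q = s^(1-a) and P = (1+s)^(1-a), multiplication by 2 - a turns it into
    P (s + a/2) - Q (s + a/2 - 1), and Q <= P. *)
Lemma ccoef0_gt0 {R : realType} (s a : R) (n : nat) : 0 < s -> 0 <= a <= 1 ->
  0 < ccoef s n 0 a.
Proof.
move=> s0 /andP[a0 a1]; rewrite /ccoef/=; case: ifP => _; first exact: powR_gt0.
rewrite /bcoef subrr add0r.
have p2 t : 0 < t -> t `^ (2 - a) = t * t `^ (1 - a).
  move=> t0; rewrite (_ : 2 - a = 1 + (1 - a)); last by lra.
  by rewrite powRD ?powRr1 ?(ltW t0)// (gt_eqF t0) implybT.
rewrite !p2 ?(addr_gt0 ltr01 s0)//.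
set P := (1 + s) `^ (1 - a); set Q := s `^ (1 - a).
have Q0 : 0 < Q by exact: powR_gt0.
have QP : Q <= P by apply: ge0_ler_powR; rewrite ?nnegrE; lra.
rewrite -(pmulr_rgt0 _ (_ : 0 < 2 - a)); last by lra.
have -> : (2 - a) * (Q + ((2 - a)^-1 * ((1 + s) * P - s * Q) - 2^-1 * (P + Q)))
  = P * (s + a / 2) - Q * (s - (2 - a) / 2).
  by field; lra.
have : Q * (s + a / 2) <= P * (s + a / 2) by rewrite ler_wpM2r//; lra.
by nra.
Qed.

(** The last term of the sum, with exponent 1 and Gamma 1 = 1, is split off: it
    makes the sum positive, for the others nonnegativity is enough. *)
Lemma chat0_gt0 {R : realType} (omega : R -> R) (J n : nat) (tau s : R) :
  (forall a : R, 0 <= a <= 1 -> 0 < omega a) ->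
  (0 < J)%N -> 0 < tau -> 0 < s -> 0 < chat omega J tau s n 0.
Proof.
move=> om0 J0 tau0 s0; have J2 : (0 : R) < (J.*2)%:R by rewrite ltr0n double_gt0.
have a01 r : (r < J.*2.+1)%N -> 0 <= alpha R J r <= 1.
  by move=> rJ; rewrite /alpha /dalpha divr_ge0//= ler_pdivrMr// mul1r ler_nat.
have lam0 r : (r < J.*2.+1)%N -> 0 < lambda omega J r.
  move=> rJ; rewrite /lambda /dalpha !mulr_gt0 ?invr_gt0 ?om0 ?a01//.
  by rewrite /dweight; case: ifP.
rewrite /chat big_nat_recr//= ltr_wpDl//.
  rewrite big_nat_cond sumr_ge0// => r /andP[/andP[_ rJ] _].
  have rJ' : (r < J.*2.+1)%N by exact: leqW.
  have /andP[a0 a1] := a01 _ rJ'.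
  apply: mulr_ge0; last by apply/ltW/ccoef0_gt0; rewrite ?a0.
  apply: mulr_ge0; first exact/ltW/lam0.
  apply: mulr_ge0; first exact: powR_ge0.
  by rewrite invr_ge0; apply: Gamma_ge0; lra.
have a1 : alpha R J J.*2 = 1 by rewrite /alpha /dalpha divff ?gt_eqF.
apply: mulr_gt0; last by apply: ccoef0_gt0; rewrite ?a01.
rewrite a1 (_ : 2 - 1 = 1); last by lra.
by rewrite Gamma1 invr1 mulr1; apply: mulr_gt0; [exact: lam0|exact: powR_gt0].
Qed.

(** * Implicit recursions with invertible steps *)

(** Levy-Desplanques: in a kernel vector, the row of an entry of largest modulus
    contradicts dominance. *)
Lemma diag_dominant_unitmx {R : realFieldType} (n : nat) (A : 'M[R]_n) :
  (forall i, \sum_(j | j != i) `|A i j| < `|A i i|) -> A \in unitmx.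
Proof.
move=> dom; rewrite unitmxE unitfE; apply/negP; rewrite -det_tr => /det0P[v v0 vA].
have [i0 vi0] : exists i, v 0 i != 0 by apply/rV0Pn.
pose i := [arg max_(i > i0) `|v 0 i|]%O.
have imax j : `|v 0 j| <= `|v 0 i|.
  by rewrite /i; case: arg_maxP => // k _; apply.
have vi : 0 < `|v 0 i| by apply: lt_le_trans (imax i0); rewrite normr_gt0.
have : A i i * v 0 i = - \sum_(j | j != i) A i j * v 0 j.
  apply/eqP; rewrite -addr_eq0 -(bigD1 i (P := xpredT) (F := fun j => A i j * v 0 j))//=.
  move/rowP: vA => /(_ i); rewrite !mxE => vAi; rewrite -[X in _ == X]vAi; apply/eqP.
  by apply: eq_bigr => j _; rewrite mxE mulrC.
move=> /(congr1 Num.norm); rewrite normrM normrN => eqi.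
have : `|A i i| * `|v 0 i| <= \sum_(j | j != i) `|A i j * v 0 j|.
  by rewrite eqi; exact: ler_norm_sum.
rewrite leNgt => /negP; apply.
apply: (@le_lt_trans _ _ (\sum_(j | j != i) `|A i j| * `|v 0 i|)).
  by apply: ler_sum => j _; rewrite normrM ler_wpM2l.
by rewrite -mulr_suml ltr_pM2r.
Qed.

(** Course-of-values recursion.  The auxiliary [hist n] is a function that is
    already correct at all arguments below n. *)
Lemma exists_causal_recursion {V : Type} (Phi : nat -> (nat -> V) -> V) (v0 : V) :
  (forall n w w', (forall k, (k < n)%N -> w k = w' k) -> Phi n w = Phi n w') ->
  exists w, forall n, w n = Phi n w.
Proof.
move=> causal.
pose hist := fix hist n : nat -> V := if n is n'.+1 then
  fun k => if k == n' then Phi n' (hist n') else hist n' k else fun=> v0.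
exists (fun n => hist n.+1 n) => n /=; rewrite eqxx; apply: causal => k.
elim: n => // n IHn; rewrite ltnS leq_eqVlt => /predU1P[->|kn].
  by rewrite /= eqxx.
by rewrite -IHn//= ltn_eqF.
Qed.

(** Existence solves the levels successively; uniqueness compares the columns by
    strong induction. *)
Lemma exists_unique_implicit_steps {R : fieldType} (m N : nat)
    (A : nat -> 'M[R]_m) (rhs : nat -> (nat -> 'cV[R]_m) -> 'cV[R]_m) :
  (forall n, A n \in unitmx) ->
  (forall n w w', (forall k, (k < n)%N -> w k = w' k) -> rhs n w = rhs n w') ->
  exists! U : 'M[R]_(m, N.+1), forall n, (n <= N)%N ->
    A n *m col (inord n) U = rhs n (fun k => col (inord k) U).
Proof.
move=> Aunit causal.
have [|w wE] := @exists_causal_recursion _ (fun n w => invmx (A n) *m rhs n w) 0.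
  by move=> n w w' ww'; rewrite (causal _ _ _ ww').
have colw n : (n <= N)%N -> col (inord n) (\matrix_(i < m, k < N.+1) w k i 0) = w n.
  by move=> nN; apply/colP => i; rewrite !mxE inordK.
exists (\matrix_(i < m, k < N.+1) w k i 0); split=> [n nN|U' U'E].
  rewrite colw// wE mulKVmx//; apply: causal => k kn.
  by rewrite colw// (leq_trans (ltnW kn)).
suff eqcol n : (n <= N)%N -> w n = col (inord n) U'.
  apply/matrixP => i k; rewrite mxE.
  by rewrite eqcol -1?ltnS// mxE inord_val.
elim/ltn_ind: n => n IHn nN; rewrite wE.
rewrite (causal _ _ (fun k => col (inord k) U')) => [|k kn].
  by rewrite -U'E// mulKmx.
by apply: IHn => //; exact: leq_trans (ltnW kn) nN.
Qed.

(** * Unique solvability of the scheme *)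

Definition interior {M : nat} (i : 'I_M.+1) := (1 <= i <= M - 1)%N.

(** Identity rows at the boundary nodes, and at every node for n = 0, let boundary
    and initial values enter as ordinary equations of the same system. *)
Definition level_matrix {R : realFieldType} {M : nat} (c : nat -> R) (kappa : R)
    (g : 'I_M.+1 -> 'I_M.+1 -> R) (n : nat) : 'M[R]_M.+1 :=
  \matrix_(i, j) if interior i && (0 < n)%N
    then c n *+ (i == j) + kappa * g i j else (i == j)%:R.

Lemma level_matrix_unitmx {R : realFieldType} {M : nat} (c : nat -> R) (kappa : R)
    (g : 'I_M.+1 -> 'I_M.+1 -> R) (n : nat) :
  (forall k, 0 < c k) -> 0 <= kappa ->
  (forall i, \sum_(j < M.+1 | j != i) `|g i j| <= g i i) ->
  level_matrix c kappa g n \in unitmx.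
Proof.
move=> c0 kappa0 gdom; apply: diag_dominant_unitmx => i; rewrite mxE eqxx.
case: (boolP (_ && _)) => [iin|iin].
  have gii : 0 <= g i i by apply: le_trans (gdom i); exact: sumr_ge0.
  rewrite mulr1n ger0_norm; last by rewrite addr_ge0 ?mulr_ge0// ltW.
  apply: le_lt_trans (_ : kappa * g i i < _); last by rewrite ltrDr.
  apply: le_trans (ler_wpM2l kappa0 (gdom i)); rewrite mulr_sumr.
  apply: ler_sum => j ji; rewrite mxE iin eq_sym (negPf ji) mulr0n add0r.
  by rewrite normrM ger0_norm.
rewrite big1 ?normr1// => j ji.
by rewrite mxE (negPf iin) eq_sym (negPf ji) normr0.
Qed.

Definition level_rhs {R : realFieldType} {M : nat} (c : nat -> nat -> R) (kappa sigma : R)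
    (g : 'I_M.+1 -> 'I_M.+1 -> R) (F : nat -> nat -> R) (phi : nat -> R)
    (n : nat) (w : nat -> 'cV[R]_M.+1) : 'cV[R]_M.+1 :=
  \col_i if ~~ interior i then 0 else if n == 0%N then phi i else
    c n 0%N * w (n - 1)%N i 0
    - (\sum_(1 <= k < n) c n k * (w (n - k)%N i 0 - w (n - k - 1)%N i 0))
    - kappa * (\sum_j g i j * ((1 - sigma) * w (n - 1)%N j 0)) + F i n.

Lemma level_rhs_causal {R : realFieldType} {M : nat} (c : nat -> nat -> R)
    (kappa sigma : R)
    (g : 'I_M.+1 -> 'I_M.+1 -> R) (F : nat -> nat -> R) (phi : nat -> R)
    (n : nat) (w w' : nat -> 'cV[R]_M.+1) :
  (forall k, (k < n)%N -> w k = w' k) ->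
  level_rhs c kappa sigma g F phi n w = level_rhs c kappa sigma g F phi n w'.
Proof.
move=> ww'; apply/colP => i; rewrite !mxE; case: ifP => // _.
case: eqVneq => // n0; rewrite ww' ?subn1 ?prednK ?lt0n//.
congr (_ - _ - _ + _).
rewrite [LHS]big_nat_cond [RHS]big_nat_cond; apply: eq_bigr => k kn.
by rewrite !ww'//; lia.
Qed.

(** The scheme is this sequence of linear systems: the term k = 0 of the temporal
    sum and the sigma-part of the spatial sum hold the unknowns of level n, and
    everything else moves to the right-hand side. *)
Lemma difference_schemeE {R : realType} (omega : R -> R) (J M N : nat)
    (L T K beta sigma : R) (f : R -> R -> R) (phi : R -> R)
    (w : nat -> 'cV[R]_M.+1) : (0 < M)%N ->
  let h := L / M%:R in let tau := T / N%:R in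
  let g (i j : 'I_M.+1) := gcoef beta (i%:Z - j%:Z) in
  let c := chat omega J tau sigma in let kappa := K * h `^ (- beta) in
  difference_scheme omega J M N L T K beta sigma f phi (fun i n => w n (inord i) 0)
  <-> forall n, (n <= N)%N ->
    level_matrix (fun n => c n 0%N) (kappa * sigma) g n *m w n =
    level_rhs c kappa sigma g (fun i n => f (i%:R * h) ((n%:R - 1 + sigma) * tau))
      (fun i => phi (i%:R * h)) n w.
Proof.
move=> M0 h tau g c kappa.
have rowE n (i : 'I_M.+1) : (level_matrix (c ^~ 0%N) (kappa * sigma) g n *m w n) i 0 =
    if interior i && (0 < n)%N
    then c n 0%N * w n i 0 + kappa * \sum_j g i j * (sigma * w n j 0) else w n i 0.
  rewrite mxE; case: ifP => iin.
    under eq_bigr => j _ do rewrite mxE iin mulrDl.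
    rewrite big_split/=; congr (_ + _).
      by rewrite (bigD1 i)//= eqxx big1 ?addr0// => j ji; rewrite eq_sym (negPf ji) mul0r.
    by rewrite mulr_sumr; apply: eq_bigr => j _; ring.
  under eq_bigr => j _ do rewrite mxE iin.
  rewrite (bigD1 i)//= eqxx mul1r big1 ?addr0// => j ji.
  by rewrite eq_sym (negPf ji) mul0r.
have stepE n (i : 'I_M.+1) : (0 < n)%N ->
  (\sum_(0 <= k < n) c n k * (w (n - k)%N i 0 - w (n - k - 1)%N i 0)
   = - K * h `^ (- beta) * (\sum_(0 <= j < M.+1) gcoef beta (i%:Z - j%:Z)
       * (sigma * w n (inord j) 0 + (1 - sigma) * w (n - 1)%N (inord j) 0))
     + f (i%:R * h) ((n%:R - 1 + sigma) * tau)) <->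
  (c n 0%N * w n i 0 + kappa * \sum_j g i j * (sigma * w n j 0) =
    c n 0%N * w (n - 1)%N i 0
    - (\sum_(1 <= k < n) c n k * (w (n - k)%N i 0 - w (n - k - 1)%N i 0))
    - kappa * (\sum_j g i j * ((1 - sigma) * w (n - 1)%N j 0))
    + f (i%:R * h) ((n%:R - 1 + sigma) * tau)).
  move=> n0; rewrite big_ltn// subn0 big_mkord.
  have -> : \sum_(j < M.+1) gcoef beta (i%:Z - j%:Z)
        * (sigma * w n (inord j) 0 + (1 - sigma) * w (n - 1)%N (inord j) 0)
      = \sum_j g i j * (sigma * w n j 0) + \sum_j g i j * ((1 - sigma) * w (n - 1)%N j 0).
    by rewrite -big_split/=; apply: eq_bigr => j _; rewrite inord_val mulrDr.
  rewrite mulNr -/kappa.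
  set S := bigop _ _ _; set S1 := bigop _ _ _; set S2 := bigop _ _ _; set y := f _ _.
  by split=> e; lra.
split.
  move=> [eqs bnd ini] n nN; apply/colP => i; rewrite rowE mxE.
  case: (boolP (interior i)) => [iin|iout] /=.
    case: posnP => [->|n0].
      by have := ini i iin; rewrite /= inord_val.
    apply/stepE => //; have := eqs i n iin; rewrite n0 nN /= inord_val.
    by apply.
  have [w0 wM] := bnd n nN.
  have [i0|iM] : i = inord 0 \/ i = inord M.
    move: iout (ltn_ord i); rewrite /interior => iout iM.
    have [i0|iM'] : i = 0%N :> nat \/ i = M :> nat by lia.
      by left; apply: val_inj; rewrite /= inordK.
    by right; apply: val_inj; rewrite /= inordK.
  - by rewrite i0.
  - by rewrite iM.
move=> eqs; have eqi n (i : 'I_M.+1) nN := congr1 (fun v : 'cV_M.+1 => v i 0) (eqs n nN).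
split.
- move=> i n iin /andP[n0 nN].
  have iM : (i < M.+1)%N by lia.
  have ii : interior (inord i : 'I_M.+1) by rewrite /interior inordK.
  move: (eqi n (inord i) nN); rewrite rowE mxE ii n0/= (gtn_eqF n0).
  by move=> /(stepE _ _ n0); rewrite inordK.
- move=> n nN; split.
    have := eqi n (inord 0) nN; rewrite rowE mxE.
    by rewrite /interior inordK.
  have := eqi n (inord M) nN; rewrite rowE mxE.
  have -> : interior (inord M : 'I_M.+1) = false by rewrite /interior inordK//; lia.
  by [].
- move=> i iin; have iM : (i < M.+1)%N by lia.
  have ii : interior (inord i : 'I_M.+1) by rewrite /interior inordK.
  have := eqi 0%N (inord i) (leq0n _); rewrite rowE mxE ii/=.
  by rewrite inordK.
Qed.

Theorem theorem2p1 (R : realType) (omega : R -> R) (J M N : nat)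
    (L T K beta sigma : R) (f : R -> R -> R) (phi : R -> R)
    (omega_ge0 : forall a : R, 0 <= a <= 1 -> 0 <= omega a)
    (omega_neq0 : forall a : R, 0 <= a <= 1 -> omega a <> 0)
    (omega_int :
      (0 < \int[lebesgue_measure]_(a in `[0%R, 1%R]) (omega a)%:E < +oo)%E)
    (J_ge1 : (1 <= J)%N) (M_ge2 : (2 <= M)%N) (N_ge1 : (1 <= N)%N)
    (L_gt0 : 0 < L) (T_gt0 : 0 < T) (K_gt0 : 0 < K)
    (beta_bounds : 1 < beta <= 2)
    (sigma_gt0 : 0 < sigma)
    (sigma_root : Fsigma omega J (T / N%:R) sigma = 0) :
  exists! u : 'M[R]_(M.+1, N.+1),
    difference_scheme omega J M N L T K beta sigma f phi
      (fun i n => u (inord i) (inord n)).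
Proof.
have omega_gt0 a : 0 <= a <= 1 -> 0 < omega a.
  by move=> a01; rewrite lt_def omega_ge0// andbT; apply/eqP; exact: omega_neq0.
have beta02 : 0 < beta <= 2 by move: beta_bounds => /andP[b1 ->]; rewrite andbT; lra.
have M_gt0 : (0 < M)%N by exact: ltnW.
pose h := L / M%:R; pose tau := T / N%:R.
pose g (i j : 'I_M.+1) := gcoef beta (i%:Z - j%:Z).
pose c := chat omega J tau sigma; pose kappa := K * h `^ (- beta).
have c_gt0 n : 0 < c n 0%N.
  by apply: chat0_gt0 => //; rewrite divr_gt0 ?ltr0n.
have kappa_ge0 : 0 <= kappa * sigma by rewrite !mulr_ge0 ?powR_ge0// ltW.
have g_dom i : \sum_(j < M.+1 | j != i) `|g i j| <= g i i.
  by rewrite {2}/g subrr; exact: sum_offdiag_gcoef.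
have [U [U_steps U_unique]] := exists_unique_implicit_steps _ N _ _
  (fun n => level_matrix_unitmx _ _ _ n c_gt0 kappa_ge0 g_dom)
  (level_rhs_causal c kappa sigma g
    (fun i n => f (i%:R * h) ((n%:R - 1 + sigma) * tau)) (fun i => phi (i%:R * h))).
have columns (V : 'M[R]_(M.+1, N.+1)) :
    (fun i n => V (inord i) (inord n)) = (fun i n => col (inord n) V (inord i) 0).
  by apply/funext => i; apply/funext => n; rewrite mxE.
exists U; split=> [|V]; rewrite columns.
  exact/difference_schemeE.
by move/(difference_schemeE _ _ _ _ _ _ _ _ _ _ _ _ M_gt0); exact: U_unique.
Qed.
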